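(* Let $n$ be a positive integer and $K$ a field. Let $\mathcal{G} \subset K[\mathbf{x}, z]$ be the set consisting of the following binomials, where $p, q, r, s$ range over all elements of $\{+,-\}$ and all indices lie in $\{1,\ldots,n\}$: (i) $x_{ij}^{pq}x_{k\ell}^{rs} - x_{ik}^{pr}x_{j\ell}^{qs}$, for $1 \leq i < j < k < \ell \leq n$; (ii) $x_{i\ell}^{ps}x_{jk}^{qr} - x_{ik}^{pr}x_{j\ell}^{qs}$, for $1 \leq i < j < k < \ell \leq n$; (iii) $x_{ij}^{+p}x_{ik}^{-q} - x_{jk}^{pq}z$, for $|\{i,j,k\}|=3$; (iv) $x_{ij}^{++}x_{ij}^{--} - z^{2}$, for $1 \leq i < j \leq n$; (v) $x_{ij}^{+-}x_{ij}^{-+} - z^{2}$, for $1 \leq i < j \leq n$; (vi) $x_{ij}^{p+}x_{ij}^{p-} - x_{1i}^{+p}x_{1i}^{-p}$, for $1 < i, j \leq n$ with $i \neq j$; (vii) $x_{1j}^{p+}x_{1j}^{p-} - x_{1n}^{p+}x_{1n}^{p-}$, for $1 < j < n$; (viii) $x_{1i}^{+p}x_{1i}^{-p}x_{jk}^{qr} - x_{ij}^{pq}x_{ik}^{pr}z$, for $1 < i, j, k \leq n$ with $|\{i,j,k\}|=3$. Then $\mathcal{G}$ is a Gröbner basis of the toric ideal $I_{\mathbf{D}_{n}^{\pm}}$ with respect to the monomial order $\prec$.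
   Context: Let $\mathbf{e}_1,\ldots,\mathbf{e}_n$ be the canonical unit coordinate vectors of $\mathbb{R}^n$. Let $\mathbf{D}_n^{\pm} \subset \mathbb{R}^n$ be the finite set consisting of the origin together with $\mathbf{e}_i+\mathbf{e}_j$, $\mathbf{e}_i-\mathbf{e}_j$, $-\mathbf{e}_i+\mathbf{e}_j$, $-\mathbf{e}_i-\mathbf{e}_j$ for $1 \leq i < j \leq n$. Let $K[\mathbf{t},\mathbf{t}^{-1},s] = K[t_1,\ldots,t_n,t_1^{-1},\ldots,t_n^{-1},s]$ (Laurent in the $t_i$, polynomial in $s$). The toric ring $K[\mathbf{D}_n^{\pm}]$ is its subring generated over $K$ by $s$ together with $t_it_js$, $t_it_j^{-1}s$, $t_i^{-1}t_js$, $t_i^{-1}t_j^{-1}s$ for $1\le i<j\le n$. Let $K[\mathbf{x},z]$ be the polynomial ring over $K$ in the variable $z$ together with the variables $x_{ij}^{pq}$ for $1\le i<j\le n$ and $p,q\in\{+,-\}$; let $K[\mathbf{x}]$ be the polynomial ring in the variables $x_{ij}^{pq}$ only. Let $\pi: K[\mathbf{x},z]\to K[\mathbf{D}_n^{\pm}]$ be the surjective $K$-algebra homomorphism with $\pi(z)=s$ and $\pi(x_{ij}^{pq}) = t_i^{p'}t_j^{q'}s$, where $+'=1$ and $-'=-1$. The toric ideal $I_{\mathbf{D}_n^{\pm}}$ is the kernel of $\pi$. Notation: for $j<i$, the symbol $x_{ij}^{pq}$ denotes the variable $x_{ji}^{qp}$. Monomial order: fix a total ordering $<$ of the variables of $K[\mathbf{x}]$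 such that, for $i<j$ and $k<\ell$, $x_{ij}^{pq} < x_{k\ell}^{rs}$ whenever either $i<k$, or $i=k$ and $j>\ell$ (for any signs $p,q,r,s$). Let $<_{\rm lex}$ be the lexicographic order on monomials of $K[\mathbf{x}]$ induced by $<$. The monomial order $\prec$ on $K[\mathbf{x},z]$ is defined as follows: for monomials $u$ of degree $a$ and $v$ of degree $b$ in $K[\mathbf{x}]$ and $\alpha,\beta\in\mathbb{Z}_{\ge 0}$, one has $u z^{\alpha} \prec v z^{\beta}$ if - $a+\alpha < b+\beta$, or - $a+\alpha = b+\beta$ and $\alpha>\beta$, or - $a=b$, $\alpha=\beta$ and $u <_{\rm lex} v$. *)

(* Defs.v *)
From mathcomp Require Import all_boot all_order all_algebra.
From mathcomp Require Import fraction.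
From mathcomp.multinomials Require Export mpoly.

Set Implicit Arguments.
Unset Strict Implicit.
Unset Printing Implicit Defensive.

Import GRing.Theory.
Local Open Scope ring_scope.

(* Signs are booleans, [true] standing for + and [false] for -. The indices
   1, ..., n are the elements of 'I_n, so that the index 1 has value 0 and the
   index n has value n.-1. *)
Local Notation pos := true (only parsing).
Local Notation neg := false (only parsing).

Section GroebnerBasis.
Variables (N : nat) (K : fieldType).

Definition ideal_span (S : {mpoly K[N]} -> Prop) (f : {mpoly K[N]}) : Prop :=
  exists2 c : seq ({mpoly K[N]} * {mpoly K[N]}),
    forall t, t \in c -> S t.2 & f = \sum_(t <- c) t.1 * t.2.

Variable lt : rel 'X_{1..N}.

Definition is_initial (f : {mpoly K[N]}) (m : 'X_{1..N}) : Prop :=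
  m \in msupp f /\ forall m', m' \in msupp f -> m' != m -> lt m' m.

Definition initial_monomials (F : {mpoly K[N]} -> Prop) (g : {mpoly K[N]}) :
    Prop :=
  exists f m, [/\ F f, f != 0, is_initial f m & g = 'X_[m]].

Definition is_groebner_basis (I G : {mpoly K[N]} -> Prop) : Prop :=
  [/\ exists s : seq {mpoly K[N]}, forall g, G g <-> g \in s,
      forall g, G g -> g != 0 /\ I g
    & forall f, ideal_span (initial_monomials G) f <->
                ideal_span (initial_monomials I) f].

End GroebnerBasis.

Section ToricIdeal.
Variable n : nat.

(* The tuple (i, j, p, q) with i < j indexes the variable x_{ij}^{pq}. *)
Definition xvar := {v : 'I_n * 'I_n * bool * bool | (v.1.1.1 < v.1.1.2)%N}.

Definition xvar_i (v : xvar) : 'I_n := (val v).1.1.1.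
Definition xvar_j (v : xvar) : 'I_n := (val v).1.1.2.
Definition xvar_p (v : xvar) : bool := (val v).1.2.
Definition xvar_q (v : xvar) : bool := (val v).2.

(* [None] indexes the variable z. *)
Definition nvars : nat := #|{: option xvar}|.
Definition xindex (v : xvar) : 'I_nvars := enum_rank (Some v).
Definition zindex : 'I_nvars := enum_rank (None : option xvar).

Definition is_var_order (lt : rel xvar) : Prop :=
  [/\ irreflexive lt, transitive lt,
      forall v w, v != w -> lt v w || lt w v
    & forall v w, (xvar_i v < xvar_i w)%N ||
                  (xvar_i v == xvar_i w) && (xvar_j w < xvar_j v)%N -> lt v w].

Section MonomialOrder.
Variable lt : rel xvar.

Definition xdeg (m : 'X_{1..nvars}) : nat := (\sum_(v : xvar) m (xindex v))%N.
Definition zdeg (m : 'X_{1..nvars}) : nat := m zindex.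

(* The largest variable at which the x-parts differ decides. *)
Definition lex_lt (m1 m2 : 'X_{1..nvars}) : bool :=
  [exists v : xvar, (m1 (xindex v) < m2 (xindex v))%N &&
    [forall w : xvar, lt v w ==> (m1 (xindex w) == m2 (xindex w))]].

Definition prec (m1 m2 : 'X_{1..nvars}) : bool :=
  [|| (xdeg m1 + zdeg m1 < xdeg m2 + zdeg m2)%N,
      (xdeg m1 + zdeg m1 == xdeg m2 + zdeg m2)%N && (zdeg m2 < zdeg m1)%N
    | [&& xdeg m1 == xdeg m2, zdeg m1 == zdeg m2 & lex_lt m1 m2]].

End MonomialOrder.

Variable K : fieldType.

(* The Laurent ring K[t, t^-1, s] is viewed inside the fraction field of
   K[t_1, ..., t_n, s]; the variable s is the last of the n.+1 variables. *)
Definition laurent_t (i : 'I_n) : {fraction {mpoly K[n.+1]}} :=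
  tofrac 'X_(widen_ord (leqnSn n) i).
Definition laurent_s : {fraction {mpoly K[n.+1]}} := tofrac 'X_ord_max.

Definition sign_exp (p : bool) : int := if p then 1 else -1.

Definition toric_var (k : 'I_nvars) : {fraction {mpoly K[n.+1]}} :=
  if enum_val k is Some v then
    laurent_t (xvar_i v) ^ sign_exp (xvar_p v) *
    laurent_t (xvar_j v) ^ sign_exp (xvar_q v) * laurent_s
  else laurent_s.

(* The image of this morphism is the toric ring. *)
Definition toric_map (f : {mpoly K[nvars]}) : {fraction {mpoly K[n.+1]}} :=
  mmap (@tofrac {mpoly K[n.+1]} \o @mpolyC n.+1 K) toric_var f.

Definition toric_ideal (f : {mpoly K[nvars]}) : Prop := toric_map f = 0.

(* For j < i this is the variable x_{ji}^{qp}; the value 0 for i = j is a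
   convention which is not used in [toric_binomial]. *)
Definition Xvar (i j : 'I_n) (p q : bool) : {mpoly K[nvars]} :=
  if insub (i, j, p, q) is Some v then 'X_(xindex v)
  else if insub (j, i, q, p) is Some v then 'X_(xindex v)
  else 0.

Definition Zvar : {mpoly K[nvars]} := 'X_zindex.

Inductive toric_binomial : {mpoly K[nvars]} -> Prop :=
| ToricBinomial1 (i j k l : 'I_n) (p q r s : bool) :
    (i < j)%N -> (j < k)%N -> (k < l)%N ->
    toric_binomial (Xvar i j p q * Xvar k l r s - Xvar i k p r * Xvar j l q s)
| ToricBinomial2 (i j k l : 'I_n) (p q r s : bool) :
    (i < j)%N -> (j < k)%N -> (k < l)%N ->
    toric_binomial (Xvar i l p s * Xvar j k q r - Xvar i k p r * Xvar j l q s)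
| ToricBinomial3 (i j k : 'I_n) (p q : bool) :
    i != j -> i != k -> j != k ->
    toric_binomial (Xvar i j pos p * Xvar i k neg q - Xvar j k p q * Zvar)
| ToricBinomial4 (i j : 'I_n) :
    (i < j)%N ->
    toric_binomial (Xvar i j pos pos * Xvar i j neg neg - Zvar ^+ 2)
| ToricBinomial5 (i j : 'I_n) :
    (i < j)%N ->
    toric_binomial (Xvar i j pos neg * Xvar i j neg pos - Zvar ^+ 2)
| ToricBinomial6 (one i j : 'I_n) (p : bool) :
    one = 0%N :> nat -> (0 < i)%N -> (0 < j)%N -> i != j ->
    toric_binomial (Xvar i j p pos * Xvar i j p neg -
                    Xvar one i pos p * Xvar one i neg p)
| ToricBinomial7 (one j last : 'I_n) (p : bool) :
    one = 0%N :> nat -> last = n.-1 :> nat -> (0 < j)%N -> (j < last)%N ->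
    toric_binomial (Xvar one j p pos * Xvar one j p neg -
                    Xvar one last p pos * Xvar one last p neg)
| ToricBinomial8 (one i j k : 'I_n) (p q r : bool) :
    one = 0%N :> nat -> (0 < i)%N -> (0 < j)%N -> (0 < k)%N ->
    i != j -> i != k -> j != k ->
    toric_binomial (Xvar one i pos p * Xvar one i neg p * Xvar j k q r -
                    Xvar i j p q * Xvar i k p r * Zvar).

End ToricIdeal.

(* Main.v *)
Require Import Defs.
From mathcomp Require Import all_boot all_order all_algebra.
From mathcomp Require Import fraction zify.
From Stdlib Require Import Classical.

(** Every binomial in the family is X^a - X^b with X^a, X^b of equal image and
    b before a in the order, so it lies in the toric ideal and has initial
    monomial X^a ([toric_binomial_leading]).  Call a monomial standard if no
    such X^a divides it.  As the image of a monomial is a Laurent monomial, an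
    element f of the toric ideal that contains a monomial m also contains a
    second monomial with the same image ([toric_ideal_fibre]).  If m is initial
    in f and standard, that second monomial is smaller than m and reduces to a
    standard monomial that is smaller than m and still has the image of m.  So
    the theorem amounts to: two standard monomials with the same image are equal
    ([standard_uniq]).

    To see this, read a monomial in the x-variables as a multigraph on the
    indices, x_{ij}^{pq} being an edge that carries the sign p at i and q at j.
    The image records, besides the total degree, the signed degree of each
    vertex.  [ToricBinomial1] and [ToricBinomial2] force disjoint edges to
    cross; the other families restrict where both signs can meet.  By
    [ToricBinomial3], if + and - both occur at x, all edges at x go to one
    neighbour c; by [ToricBinomial4] and [ToricBinomial5] they then have the
    same sign at c; by [ToricBinomial6] and [ToricBinomial7], either x = 1, or
    c = 1 and x = n; and then [ToricBinomial8], respectively [ToricBinomial2],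
    leaves only edges through c.  Hence a standard monomial either has a
    constant sign at every vertex, or is a star with one sign at its centre c
    and both signs at a vertex determined by c ([standard_dichotomy]).

    The image tells these cases apart.  With constant signs the absolute values
    of the signed degrees are the degrees, and none exceeds the sum of the
    others; for a star, the one at c does, because signs cancel at x.  Two stars
    with the same image have the same centre and hence an edge in common.  Two
    monomials with constant signs have the same degrees; their edges form a
    chain i_1 <= ... <= i_r <= j_1 <= ... <= j_r for the endpoints i_k < j_k, so
    the least edge can be read off from the degrees and is common to both
    ([sorted_common]).  Dividing by a common variable, induction on the number
    of edges gives uniqueness. *)

Set Implicit Arguments.
Unset Strict Implicit.
Unset Printing Implicit Defensive.

Import GRing.Theory.
Local Open Scope ring_scope.

(** * Degrees and the monomial order *)

Section Degrees.
Variable n : nat.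
Implicit Types (m : 'X_{1..nvars n}) (v w : xvar n).

Lemma xindex_inj : injective (@xindex n).
Proof. by move=> v w /enum_rank_inj[]. Qed.

Lemma xindex_eq v w : (xindex v == xindex w) = (v == w).
Proof. exact: inj_eq xindex_inj _ _. Qed.

Lemma xindex_zindex v : (xindex v == zindex n) = false.
Proof. by rewrite (inj_eq enum_rank_inj). Qed.

Lemma zindex_xindex v : (zindex n == xindex v) = false.
Proof. by rewrite eq_sym xindex_zindex. Qed.

Lemma big_nvars (M : Type) (idx : M) (op : Monoid.com_law idx)
    (F : 'I_(nvars n) -> M) :
  \big[op/idx]_k F k = op (F (zindex n)) (\big[op/idx]_v F (xindex v)).
Proof.
rewrite (reindex enum_rank) /=; last by apply/onW_bij/enum_rank_bij.
rewrite (bigD1 None) //=; congr (op _ _).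
rewrite (reindex_omap Some id) //= => [|[v|]]//.
by apply: eq_bigl => v; rewrite eqxx.
Qed.

Lemma monomial_ext m1 m2 :
  m1 (zindex n) = m2 (zindex n) ->
  (forall v, m1 (xindex v) = m2 (xindex v)) -> m1 = m2.
Proof.
move=> ez ex; apply/mnmP => k; rewrite -(enum_valK k).
by case: (enum_val k) => [v|]; [apply: ex | apply: ez].
Qed.

Lemma mdeg_xz m : mdeg m = (xdeg m + zdeg m)%N.
Proof. by rewrite mdegE big_nvars addnC. Qed.

Lemma zdegD m1 m2 : zdeg (m1 + m2) = (zdeg m1 + zdeg m2)%N.
Proof. by rewrite /zdeg mnmDE. Qed.

Lemma xdegD m1 m2 : xdeg (m1 + m2) = (xdeg m1 + xdeg m2)%N.
Proof. by rewrite /xdeg -big_split; apply: eq_bigr => v _; rewrite mnmDE. Qed.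

Lemma zdeg_x v : zdeg U_(xindex v) = 0%N.
Proof. by rewrite /zdeg mnm1E xindex_zindex. Qed.

Lemma zdeg_z : zdeg U_(zindex n) = 1%N.
Proof. by rewrite /zdeg mnm1E eqxx. Qed.

Lemma xdeg_x v : xdeg U_(xindex v) = 1%N.
Proof. by have := mdeg1 (xindex v); rewrite mdeg_xz zdeg_x addn0. Qed.

Lemma xdeg_z : xdeg U_(zindex n) = 0%N.
Proof. by have := mdeg1 (zindex n); rewrite mdeg_xz zdeg_z addn1 => -[]. Qed.

Definition degE := (xdegD, zdegD, xdeg_x, xdeg_z, zdeg_x, zdeg_z).

Lemma xdeg_gt0P m : reflect (exists v, 0 < m (xindex v))%N (0 < xdeg m)%N.
Proof.
rewrite lt0n sum_nat_eq0 negb_forall.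
by apply: (iffP existsP) => -[v mv]; exists v; rewrite lt0n in mv *.
Qed.

Variable lt : rel (xvar n).
Hypothesis lt_order : is_var_order lt.

Lemma prec_irr m : prec lt m m = false.
Proof.
rewrite /prec /lex_lt !ltnn !eqxx /=; apply/existsP => -[v].
by rewrite ltnn.
Qed.

Lemma lex_lt_trans : transitive (lex_lt lt).
Proof.
case: lt_order => _ lt_trans lt_total _ m2 m1 m3; rewrite /lex_lt.
move=> /existsP[v /andP[lt12 /forallP/= eq12]].
move=> /existsP[w /andP[lt23 /forallP/= eq23]].
have {}eq12 u : lt v u -> m1 (xindex u) = m2 (xindex u).
  by move=> vu; apply/eqP; have:= eq12 u; rewrite vu.
have {}eq23 u : lt w u -> m2 (xindex u) = m3 (xindex u).
  by move=> vu; apply/eqP; have:= eq23 u; rewrite vu.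
have [vw|] := eqVneq v w.
  apply/existsP; exists v; rewrite {2}vw in lt12 *; subst w.
  rewrite (ltn_trans lt12 lt23) /=; apply/forallP => u; apply/implyP => vu.
  by rewrite eq12 // eq23.
move=> /lt_total/orP[vw|wv]; apply/existsP.
  exists w; rewrite eq12 // lt23 /=; apply/forallP => u; apply/implyP => wu.
  by rewrite eq12 ?eq23 //; apply: lt_trans wu.
exists v; rewrite -eq23 // lt12 /=; apply/forallP => u; apply/implyP => vu.
by rewrite eq12 ?eq23 //; apply: lt_trans vu.
Qed.

Lemma prec_trans : transitive (prec lt).
Proof.
move=> m2 m1 m3; rewrite /prec => /or3P H12 /or3P H23; apply/or3P.
have := @lex_lt_trans m2 m1 m3.
case: H12 => [h|/andP[/eqP h h']|/and3P[/eqP h /eqP h' ->]];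
case: H23 => [k|/andP[/eqP k k']|/and3P[/eqP k /eqP k' ->]] l; 
 try (by constructor 1; lia); try (by constructor 2; lia).
by constructor 3; rewrite l // h h' k k' !eqxx.
Qed.

Lemma prec_add m m1 m2 : prec lt m1 m2 -> prec lt (m + m1) (m + m2).
Proof.
rewrite /prec !xdegD !zdegD.
case/or3P => [h|/andP[/eqP h h']|/and3P[/eqP -> /eqP -> l]]; apply/or3P;
  [by constructor 1; lia | by constructor 2; lia | constructor 3].
rewrite !eqxx /=; case/existsP: l => v /andP[lt12 /forallP eq12].
apply/existsP; exists v; rewrite !mnmDE ltn_add2l lt12 /=.
by apply/forallP => w; rewrite !mnmDE eqn_add2l.
Qed.

(** A smaller monomial has no larger total degree, so only finitely many
    monomials lie below a given one, and the order is well founded. *)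
Lemma prec_ind (P : 'X_{1..nvars n} -> Prop) :
  (forall m, (forall m', prec lt m' m -> P m') -> P m) -> forall m, P m.
Proof.
move=> IH m; pose below (d : nat) (x : 'X_{1..nvars n}) :=
  #|[set y : 'X_{1..(nvars n) < d} | prec lt y x]|.
have [d] := ubnP (mdeg m); move: {2}(below d m).+1 (ltnSn (below d m)) => c.
elim: c m => // c IHc m; rewrite ltnS => bm dm; apply: IH => m' m'm.
have dm' : (mdeg m' < d)%N.
  apply: leq_ltn_trans dm; rewrite !mdeg_xz.
  by move: m'm; rewrite /prec => /or3P[|/andP[]|/and3P[]]; lia.
apply: IHc => //; apply: leq_trans bm; apply: proper_card.
apply/properP; split.
  by apply/subsetP => y; rewrite !inE => ym'; apply: prec_trans m'm.
by exists (BMultinom dm'); rewrite !inE //= prec_irr.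
Qed.

Lemma prec_zdeg m1 m2 :
  (xdeg m1 + zdeg m1 = xdeg m2 + zdeg m2)%N -> (zdeg m2 < zdeg m1)%N ->
  prec lt m1 m2.
Proof. by rewrite /prec => /eqP-> ->; rewrite orbT. Qed.

(** The largest variable [w] occurs on one side only and decides. *)
Lemma prec_pair v w v' w' :
  lt v w -> lt v' w -> lt w' w ->
  prec lt (U_(xindex v') + U_(xindex w')) (U_(xindex v) + U_(xindex w)).
Proof.
case: lt_order => lt_irr lt_trans _ _ vw v'w w'w.
have lt_neq x y : lt x y -> (x == y) = false.
  by move=> xy; apply/eqP => e; rewrite e lt_irr in xy.
rewrite /prec !degE /=; apply/existsP; exists w.
rewrite !mnmDE !mnm1E !xindex_eq eqxx addn1 !lt_neq //=.
apply/forallP => x; apply/implyP => wx; rewrite !mnmDE !mnm1E !xindex_eq.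
by rewrite !lt_neq //; apply: lt_trans wx.
Qed.

Lemma prec_pair_below v w v' w' : v != w ->
  (forall x y, (x == v') || (x == w') -> (y == v) || (y == w) -> lt x y) ->
  prec lt (U_(xindex v') + U_(xindex w')) (U_(xindex v) + U_(xindex w)).
Proof.
case: lt_order => _ _ lt_total _ /lt_total/orP[vw|wv] below.
  by apply: prec_pair => //; apply: below; rewrite eqxx ?orbT.
by rewrite [X in prec _ _ X]addmC; apply: prec_pair => //;
  apply: below; rewrite ?eqxx ?orbT.
Qed.

End Degrees.

(** * Images of monomials *)

Section Exponents.
Variable n : nat.
Implicit Types (m : 'X_{1..nvars n}) (v w : xvar n) (x : 'I_n).

Definition tindex x : 'I_n.+1 := widen_ord (leqnSn n) x.

(** The image of the variable [v] is the quotient of two monomials with these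
    exponents.  Keeping them apart avoids negative exponents. *)
Definition xnumer v : 'X_{1..n.+1} :=
  (U_(tindex (xvar_i v)) *+ xvar_p v + U_(tindex (xvar_j v)) *+ xvar_q v
   + U_(ord_max))%MM.

Definition xdenom v : 'X_{1..n.+1} :=
  (U_(tindex (xvar_i v)) *+ ~~ xvar_p v
   + U_(tindex (xvar_j v)) *+ ~~ xvar_q v)%MM.

(** [numer] and [denom] are locked so that rewriting with the coordinates of a
    sum of exponents does not open them. *)
Definition numer m : 'X_{1..n.+1} :=
  locked (\sum_v xnumer v *+ m (xindex v) + U_(ord_max) *+ zdeg m)%MM.

Definition denom m : 'X_{1..n.+1} :=
  locked (\sum_v xdenom v *+ m (xindex v))%MM.

Lemma numerE m :
  numer m = (\sum_v xnumer v *+ m (xindex v) + U_(ord_max) *+ zdeg m)%MM.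
Proof. by rewrite /numer -lock. Qed.

Lemma denomE m : denom m = (\sum_v xdenom v *+ m (xindex v))%MM.
Proof. by rewrite /denom -lock. Qed.

Lemma tindex_eq x y : (tindex x == tindex y) = (x == y).
Proof. by []. Qed.

Lemma tindex_max x : (tindex x == ord_max) = false.
Proof. by rewrite -val_eqE /= ltn_eqF. Qed.

Lemma max_tindex x : (ord_max == tindex x) = false.
Proof. by rewrite eq_sym tindex_max. Qed.

Lemma numerD m1 m2 : numer (m1 + m2) = (numer m1 + numer m2)%MM.
Proof.
apply/mnmP => k; rewrite !numerE !mnmDE !mnm_sumE !mulmnE zdegD mulnDr.
rewrite addnACA.
by congr (_ + _)%N; rewrite -big_split; apply: eq_bigr => v _;
  rewrite !mulmnE mnmDE mulnDr.
Qed.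

Lemma denomD m1 m2 : denom (m1 + m2) = (denom m1 + denom m2)%MM.
Proof.
apply/mnmP => k; rewrite !(numerE, denomE) !mnmDE !mnm_sumE -big_split.
by apply: eq_bigr => v _; rewrite !mulmnE mnmDE mulnDr.
Qed.

Lemma numer_x v : numer U_(xindex v) = xnumer v.
Proof.
apply/mnmP => k; rewrite numerE mnmDE mnm_sumE mulmnE zdeg_x muln0 addn0.
rewrite (bigD1 v) //= mulmnE mnm1E eqxx muln1 big1 ?addn0 // => w wv.
by rewrite mulmnE mnm1E xindex_eq eq_sym (negPf wv) muln0.
Qed.

Lemma denom_x v : denom U_(xindex v) = xdenom v.
Proof.
apply/mnmP => k; rewrite !(numerE, denomE) mnm_sumE.
rewrite (bigD1 v) //= mulmnE mnm1E eqxx muln1 big1 ?addn0 // => w wv.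
by rewrite mulmnE mnm1E xindex_eq eq_sym (negPf wv) muln0.
Qed.

Lemma numer_z : numer U_(zindex n) = U_(ord_max)%MM.
Proof.
apply/mnmP => k; rewrite numerE mnmDE mnm_sumE mulmnE zdeg_z muln1.
by rewrite big1 // => v _; rewrite mulmnE mnm1E zindex_xindex muln0.
Qed.

Lemma denom_z : denom U_(zindex n) = 0%MM.
Proof.
apply/mnmP => k; rewrite !(numerE, denomE) mnm_sumE mnm0E.
by rewrite big1 // => v _; rewrite mulmnE mnm1E zindex_xindex muln0.
Qed.

Definition expE := (numerD, denomD, numer_x, denom_x, numer_z, denom_z).

Lemma numer_max m : numer m ord_max = (xdeg m + zdeg m)%N.
Proof.
rewrite numerE mnmDE mnm_sumE mulmnE mnm1E eqxx mul1n; congr (_ + _)%N.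
apply: eq_bigr => v _.
by rewrite mulmnE !mnmDE !mulmnE !mnm1E !tindex_max eqxx mul1n.
Qed.

Lemma denom_max m : denom m ord_max = 0%N.
Proof.
rewrite denomE mnm_sumE big1 // => v _.
by rewrite mulmnE !mnmDE !mulmnE !mnm1E !tindex_max.
Qed.

(** A common denominator for the images of all monomials of bounded degree. *)
Lemma denom_le m k : (denom m k <= 2 * mdeg m)%N.
Proof.
rewrite mdeg_xz mulnDr; apply: leq_trans (leq_addr _ _).
rewrite denomE mnm_sumE /xdeg big_distrr; apply: leq_sum => v _.
rewrite mulmnE leq_mul2r !mnmDE !mulmnE !mnm1E; apply/orP; right.
have le1 (b c : bool) : (b * c <= 1)%N by case: b; case: c.
exact: leq_add (le1 _ _) (le1 _ _).
Qed.

Variable K : fieldType.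
Local Notation "f %:F" := (@tofrac {mpoly K[n.+1]} f).

Lemma toric_var_x v :
  toric_var K (xindex v) * 'X_[xdenom v]%:F = 'X_[xnumer v]%:F.
Proof.
rewrite /toric_var /xindex enum_rankK /laurent_t /laurent_s.
rewrite /xdenom /xnumer !mpolyXD !tofracM -!/(tindex _).
have signed x (p : bool) :
    ('X_(tindex x))%:F ^ sign_exp p * 'X_[U_(tindex x) *+ ~~ p]%:F
    = 'X_[U_(tindex x) *+ p]%:F.
  case: p; rewrite ?mulm0n ?mulm1n mpolyX0 tofrac1; first by rewrite mulr1.
  by rewrite mulVf // tofrac_eq0 -msupp_eq0 msuppX.
rewrite -(signed (xvar_i v) (xvar_p v)) -(signed (xvar_j v) (xvar_q v)).
by rewrite mulrAC; congr (_ * _); rewrite mulrACA.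
Qed.

Lemma toric_mapX m :
  toric_map ('X_[m] : {mpoly K[nvars n]}) * 'X_[denom m]%:F = 'X_[numer m]%:F.
Proof.
rewrite /toric_map mmapX /mmap1 big_nvars /= numerE denomE.
rewrite mpolyXD tofracM -mulrA [RHS]mulrC; congr (_ * _).
  by rewrite /toric_var /zindex enum_rankK -mpolyXn tofracXn.
rewrite -!mprodXnE !rmorph_prod -big_split; apply: eq_bigr => v _ /=.
by rewrite !tofracXn -exprMn toric_var_x.
Qed.

End Exponents.

Section Fibres.
Variable n : nat.
Implicit Types (m : 'X_{1..nvars n}).

(** Equality of the images of [m1] and [m2], multiplied out. *)
Definition same_fibre m1 m2 : Prop :=
  (numer m1 + denom m2 = numer m2 + denom m1)%MM.

Lemma same_fibre_deg m1 m2 :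
  same_fibre m1 m2 -> (xdeg m1 + zdeg m1 = xdeg m2 + zdeg m2)%N.
Proof.
rewrite /same_fibre => /mnmP/(_ ord_max).
by rewrite !mnmDE !numer_max !denom_max !addn0.
Qed.

Lemma same_fibre_sym m1 m2 : same_fibre m1 m2 -> same_fibre m2 m1.
Proof. by []. Qed.

Lemma same_fibre_trans m2 m1 m3 :
  same_fibre m1 m2 -> same_fibre m2 m3 -> same_fibre m1 m3.
Proof.
rewrite /same_fibre => /mnmP h12 /mnmP h23; apply/mnmP => k.
by move: (h12 k) (h23 k); rewrite !mnmDE; lia.
Qed.

Lemma same_fibre_add m m1 m2 :
  same_fibre (m + m1) (m + m2) <-> same_fibre m1 m2.
Proof.
rewrite /same_fibre !numerD !denomD.
by split=> /mnmP h; apply/mnmP => k; move: (h k); rewrite !mnmDE; lia.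
Qed.

Variable K : fieldType.
Local Notation "f %:F" := (@tofrac {mpoly K[n.+1]} f).

(** After multiplication by a common denominator the images of the monomials of
    [f] become monomials of a polynomial ring, and the coefficient of the image
    of [m] has to cancel. *)
Lemma toric_ideal_fibre (f : {mpoly K[nvars n]}) m :
  toric_ideal f -> m \in msupp f ->
  exists m', [/\ m' \in msupp f, m' != m & same_fibre m' m].
Proof.
move=> f0 mf; pose C : 'X_{1..n.+1} := [multinom (2 * msize f)%N | k < n.+1].
pose Z m' := (numer m' + (C - denom m'))%MM.
have denomC m' : m' \in msupp f -> (denom m' <= C)%MM.
  move=> /msize_mdeg_lt ltf; apply/mnm_lepP => k; rewrite mnmE.
  by apply: leq_trans (denom_le m' k) _; rewrite leq_mul2l ltnW.
have Zfibre m' : m' \in msupp f -> Z m' = Z m -> same_fibre m' m.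
  rewrite /same_fibre /Z => /denomC/mnm_lepP le' /mnmP eqZ; apply/mnmP => k.
  have /mnm_lepP le := denomC m mf.
  by move: (eqZ k) (le k) (le' k); rewrite !mnmDE !mnmBE; lia.
have: \sum_(m' <- msupp f) f@_m' *: 'X_[Z m'] = 0 :> {mpoly K[n.+1]}.
  apply/eqP; rewrite -tofrac_eq0 raddf_sum; apply/eqP.
  transitivity (toric_map f * 'X_[C]%:F); last by rewrite f0 mul0r.
  rewrite /toric_map /mmap mulr_suml; apply: eq_big_seq => m' m'f /=.
  rewrite -mul_mpolyC tofracM -mulrA; congr (_ * _).
  rewrite mpolyXD tofracM -toric_mapX -mulrA -tofracM -mpolyXD addmC.
  by rewrite submK ?denomC // /toric_map mmapX.
move/(congr1 (mcoeff (Z m))); rewrite raddf_sum mcoeff0 /=.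
rewrite (bigD1_seq m) ?msupp_uniq //= mcoeffZ mcoeffX eqxx mulr1 => sum0.
have [/hasP[m' m'f /andP[ne /eqP eqZ]]|/hasPn none] :=
  boolP (has (fun m' => (m' != m) && (Z m' == Z m)) (msupp f)).
  by exists m'; split=> //; apply: Zfibre.
move: mf; rewrite mcoeff_msupp -sum0 big1_seq ?addr0 ?eqxx // => m' /andP[ne].
move=> /none; rewrite ne /= mcoeffZ mcoeffX => /negPf->.
by rewrite mulr0.
Qed.

Lemma same_fibre_toric m1 m2 :
  same_fibre m1 m2 -> toric_ideal ('X_[m1] - 'X_[m2] : {mpoly K[nvars n]}).
Proof.
move=> fib; rewrite /toric_ideal /toric_map mmapB -!/(toric_map _).
have X_neq0 (e : 'X_{1..n.+1}) : 'X_[e]%:F != 0.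
  by rewrite tofrac_eq0 -msupp_eq0 msuppX.
apply/eqP; rewrite subr_eq0; apply/eqP.
apply: (mulIf (X_neq0 (denom m1))); apply: (mulIf (X_neq0 (denom m2))).
rewrite toric_mapX -tofracM -mpolyXD fib mulrAC toric_mapX.
by rewrite -tofracM -mpolyXD.
Qed.

End Fibres.

(** * The binomials and their initial monomials *)

Section Leading.
Variable n : nat.
Implicit Types (m : 'X_{1..nvars n}) (v w : xvar n) (i j k l : 'I_n).
Implicit Types p q r s : bool.

(** [joins v i j p q] says that x_{ij}^{pq} denotes [v] when x_{ij}^{pq} and
    x_{ji}^{qp} are two names of one variable. *)
Definition joins v i j p q : bool :=
  (val v == (i, j, p, q)) || (val v == (j, i, q, p)).

Lemma joins_sym v i j p q : joins v i j p q = joins v j i q p.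
Proof. by rewrite /joins orbC. Qed.

Lemma joins_self v : joins v (xvar_i v) (xvar_j v) (xvar_p v) (xvar_q v).
Proof.
rewrite /joins /xvar_i /xvar_j /xvar_p /xvar_q.
by case: (val v) => [[[i j] p] q]; rewrite eqxx.
Qed.

Lemma xvar_lt v : (xvar_i v < xvar_j v)%N.
Proof. exact: valP v. Qed.

Variant joins_spec v i j p q : Prop :=
| JoinsFwd of (i < j)%N & xvar_i v = i & xvar_j v = j
    & xvar_p v = p & xvar_q v = q
| JoinsBwd of (j < i)%N & xvar_i v = j & xvar_j v = i
    & xvar_p v = q & xvar_q v = p.

Lemma joinsP v i j p q : joins v i j p q -> joins_spec v i j p q.
Proof.
rewrite /joins => /orP[] /eqP ev; have := xvar_lt v;
rewrite /xvar_i /xvar_j ev /= => lt_ij.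
  by apply: JoinsFwd; rewrite // /xvar_i /xvar_j /xvar_p /xvar_q ev.
by apply: JoinsBwd; rewrite // /xvar_i /xvar_j /xvar_p /xvar_q ev.
Qed.

Lemma joins_neq v i j p q : joins v i j p q -> i != j.
Proof. by case/joinsP; rewrite neq_ltn => ->; rewrite ?orbT. Qed.

Lemma joins_min v i j p q : joins v i j p q -> xvar_i v = minn i j :> nat.
Proof. by case/joinsP => h -> *; lia. Qed.

Lemma joins_max v i j p q : joins v i j p q -> xvar_j v = maxn i j :> nat.
Proof. by case/joinsP => h _ -> *; lia. Qed.

Lemma joins_inj v w i j p q : joins v i j p q -> joins w i j p q -> v = w.
Proof.
move=> /orP[] /eqP ev /orP[] /eqP ew; apply: val_inj; rewrite ev ew //.
  by move: (valP v) (valP w); rewrite ev ew /=; lia.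
by move: (valP v) (valP w); rewrite ev ew /=; lia.
Qed.

Lemma joins_signs v i j p q r s :
  joins v i j p q -> joins v i j r s -> p = r /\ q = s.
Proof.
by case/joinsP => lt_ij _ _ <- <-; case/joinsP => lt_ij' _ _ <- <- //;
  move: (ltn_trans lt_ij lt_ij'); rewrite ltnn.
Qed.

Lemma joins_ex i j p q : i != j -> exists v, joins v i j p q.
Proof.
rewrite neq_ltn => /orP[] lt_ij.
  by exists (Sub (i, j, p, q) lt_ij); rewrite /joins SubK eqxx.
by exists (Sub (j, i, q, p) lt_ij); rewrite /joins SubK eqxx orbT.
Qed.

Lemma joins_numer v i j p q : joins v i j p q ->
  xnumer v = (U_(tindex i) *+ p + U_(tindex j) *+ q + U_(ord_max))%MM.
Proof.
case/joinsP => _; rewrite /xnumer => -> -> -> -> //.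
by rewrite [X in (X + _)%MM]addmC.
Qed.

Lemma joins_denom v i j p q : joins v i j p q ->
  xdenom v = (U_(tindex i) *+ ~~ p + U_(tindex j) *+ ~~ q)%MM.
Proof.
by case/joinsP => _; rewrite /xdenom => -> -> -> -> //; rewrite addmC.
Qed.

Variables (K : fieldType) (lt : rel (xvar n)).
Hypothesis lt_order : is_var_order lt.
Local Notation X := (@Xvar n K).
Local Notation Z := (Zvar n K).
Local Notation "`U v" := (U_(xindex v))%MM (at level 5, v at level 2).

Lemma joins_X v i j p q : joins v i j p q -> X i j p q = 'X_(xindex v).
Proof.
rewrite /Xvar => vij; case: insubP => [w _ ew|/negbTE nlt].
  by rewrite (@joins_inj w v i j p q) // /joins ew eqxx.
case: insubP => [w _ ew|/negbTE nlt'].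
  by rewrite (@joins_inj w v i j p q) // /joins ew eqxx orbT.
by case/joinsP: vij; rewrite /= in nlt nlt' *; rewrite ?nlt ?nlt'.
Qed.

Lemma lt_joins v w i j p q k l r s : joins v i j p q -> joins w k l r s ->
  (minn i j < minn k l)%N \/ minn i j = minn k l /\ (maxn k l < maxn i j)%N ->
  lt v w.
Proof.
case: lt_order => _ _ _ lt_idx vij wkl lt_vw; apply: lt_idx.
rewrite -val_eqE /= (joins_min vij) (joins_min wkl) (joins_max vij).
rewrite (joins_max wkl).
by case: lt_vw => [->|[-> ->]]; rewrite ?eqxx ?orbT.
Qed.

(** Reduction by such a [g] turns a multiple of X^a into a smaller monomial with
    the same image. *)
Definition leading (g : {mpoly K[nvars n]}) (a : 'X_{1..nvars n}) : Prop :=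
  exists b, [/\ g = 'X_[a] - 'X_[b], prec lt b a & same_fibre b a].

Ltac fibre :=
  rewrite /same_fibre !expE;
  repeat match goal with H : is_true (joins _ _ _ _ _) |- _ =>
    rewrite ?(joins_numer H) ?(joins_denom H); clear H end;
  apply/mnmP => ?; rewrite !(mnmDE, mulmnE, mnm0E) /=; lia.

Lemma leading1 v w i j k l p q r s : (i < j)%N -> (j < k)%N -> (k < l)%N ->
  joins v i j p q -> joins w k l r s ->
  leading (X i j p q * X k l r s - X i k p r * X j l q s) (`U v + `U w).
Proof.
move=> ij jk kl vij wkl.
have [|v' v'P] := @joins_ex i k p r; first by rewrite -val_eqE /=; lia.
have [|w' w'P] := @joins_ex j l q s; first by rewrite -val_eqE /=; lia.
exists (`U v' + `U w')%MM; split.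
- by rewrite !mpolyXD (joins_X vij) (joins_X wkl) (joins_X v'P) (joins_X w'P).
- by apply: prec_pair => //; [apply: lt_joins vij wkl _
    | apply: lt_joins v'P wkl _ | apply: lt_joins w'P wkl _]; lia.
- by fibre.
Qed.

Lemma leading2 v w i j k l p q r s : (i < j)%N -> (j < k)%N -> (k < l)%N ->
  joins v i l p s -> joins w j k q r ->
  leading (X i l p s * X j k q r - X i k p r * X j l q s) (`U v + `U w).
Proof.
move=> ij jk kl vil wjk.
have [|v' v'P] := @joins_ex i k p r; first by rewrite -val_eqE /=; lia.
have [|w' w'P] := @joins_ex j l q s; first by rewrite -val_eqE /=; lia.
exists (`U v' + `U w')%MM; split.
- by rewrite !mpolyXD (joins_X vil) (joins_X wjk) (joins_X v'P) (joins_X w'P).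
- by apply: prec_pair => //; [apply: lt_joins vil wjk _
    | apply: lt_joins v'P wjk _ | apply: lt_joins w'P wjk _]; lia.
- by fibre.
Qed.

(** Here, and in [leading45] and [leading8], the second term has the larger
    power of z, which makes it the smaller one at equal total degree. *)
Lemma leading3 v w i j k p q : j != k ->
  joins v i j true p -> joins w i k false q ->
  leading (X i j true p * X i k false q - X j k p q * Z) (`U v + `U w).
Proof.
move=> jk vij wik; have [u uP] := joins_ex p q jk.
exists (`U u + U_(zindex n))%MM; split.
- by rewrite !mpolyXD (joins_X vij) (joins_X wik) (joins_X uP).
- by apply: prec_zdeg; rewrite !degE.
- by fibre.
Qed.

Lemma leading45 v w i j p q :
  joins v i j p q -> joins w i j (~~ p) (~~ q) ->
  leading (X i j p q * X i j (~~ p) (~~ q) - Z ^+ 2) (`U v + `U w).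
Proof.
move=> vij wij; exists (U_(zindex n) + U_(zindex n))%MM; split.
- by rewrite !mpolyXD (joins_X vij) (joins_X wij).
- by apply: prec_zdeg; rewrite !degE.
- by case: p q vij wij => [] [] vij wij; fibre.
Qed.

(** The order between the two variables of the first term is left open by
    [is_var_order]; both exceed the variables of the second term, whose smaller
    index is 1. *)
Lemma leading6 v w i1 i j p : i1 = 0%N :> nat -> (0 < i)%N -> (0 < j)%N ->
  joins v i j p true -> joins w i j p false ->
  leading (X i j p true * X i j p false - X i1 i true p * X i1 i false p)
    (`U v + `U w).
Proof.
move=> i10 i_gt0 j_gt0 vij wij.
have i1i : i1 != i by rewrite -val_eqE /=; lia.
have [v' v'P] := joins_ex true p i1i; have [w' w'P] := joins_ex false p i1i.
exists (`U v' + `U w')%MM; split.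
- by rewrite !mpolyXD (joins_X vij) (joins_X wij) (joins_X v'P) (joins_X w'P).
- apply: prec_pair_below => //; first by apply: contraTneq wij => <-; apply/negP
    => /(joins_signs vij)[].
  by move=> x y /orP[]/eqP-> /orP[]/eqP->;
   [apply: lt_joins v'P vij _ | apply: lt_joins v'P wij _
   |apply: lt_joins w'P vij _ | apply: lt_joins w'P wij _]; lia.
- by fibre.
Qed.

Lemma leading7 v w i1 j (il : 'I_n) p :
  i1 = 0%N :> nat -> (0 < j)%N -> (j < il)%N ->
  joins v i1 j p true -> joins w i1 j p false ->
  leading (X i1 j p true * X i1 j p false - X i1 il p true * X i1 il p false)
    (`U v + `U w).
Proof.
move=> i10 j_gt0 j_lt vij wij.
have i1l : i1 != il by rewrite -val_eqE /=; lia.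
have [v' v'P] := joins_ex p true i1l; have [w' w'P] := joins_ex p false i1l.
exists (`U v' + `U w')%MM; split.
- by rewrite !mpolyXD (joins_X vij) (joins_X wij) (joins_X v'P) (joins_X w'P).
- apply: prec_pair_below => //; first by apply: contraTneq wij => <-; apply/negP
    => /(joins_signs vij)[].
  by move=> x y /orP[]/eqP-> /orP[]/eqP->;
   [apply: lt_joins v'P vij _ | apply: lt_joins v'P wij _
   |apply: lt_joins w'P vij _ | apply: lt_joins w'P wij _]; lia.
- by fibre.
Qed.

Lemma leading8 u v w i1 i j k p q r : i != j -> i != k ->
  joins u i1 i true p -> joins v i1 i false p -> joins w j k q r ->
  leading (X i1 i true p * X i1 i false p * X j k q r
           - X i j p q * X i k p r * Z) (`U u + `U v + `U w).
Proof.
move=> ij ik uP vP wP.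
have [v' v'P] := joins_ex p q ij; have [w' w'P] := joins_ex p r ik.
exists (`U v' + `U w' + U_(zindex n))%MM; split.
- by rewrite !mpolyXD (joins_X uP) (joins_X vP) (joins_X wP) (joins_X v'P)
    (joins_X w'P).
- by apply: prec_zdeg; rewrite !degE.
- by fibre.
Qed.

(** The degree bound makes the family visibly finite. *)
Lemma toric_binomial_leading g :
  toric_binomial g -> exists2 a, leading g a & (mdeg a < 4)%N.
Proof.
case=> [i j k l p q r s ij jk kl | i j k l p q r s ij jk kl | i j k p q ij ik jk
  | i j ij | i j ij | i1 i j p i10 i_gt0 j_gt0 ij | i1 j il p i10 ill j_gt0 jl
  | i1 i j k p q r i10 i_gt0 j_gt0 k_gt0 ij ik jk].
- have [|v vP] := @joins_ex i j p q; first by rewrite -val_eqE /=; lia.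
  have [|w wP] := @joins_ex k l r s; first by rewrite -val_eqE /=; lia.
  by eexists; [apply: leading1 vP wP | rewrite !mdegD !mdeg1].
- have [|v vP] := @joins_ex i l p s; first by rewrite -val_eqE /=; lia.
  have [|w wP] := @joins_ex j k q r; first by rewrite -val_eqE /=; lia.
  by eexists; [apply: leading2 vP wP | rewrite !mdegD !mdeg1].
- have [v vP] := joins_ex true p ij; have [w wP] := joins_ex false q ik.
  by eexists; [apply: leading3 vP wP | rewrite !mdegD !mdeg1].
- have {}ij : i != j by rewrite -val_eqE /=; lia.
  have [v vP] := joins_ex true true ij; have [w wP] := joins_ex false false ij.
  by eexists; [apply: leading45 vP wP | rewrite !mdegD !mdeg1].
- have {}ij : i != j by rewrite -val_eqE /=; lia.
  have [v vP] := joins_ex true false ij; have [w wP] := joins_ex false true ij.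
  by eexists; [apply: leading45 vP wP | rewrite !mdegD !mdeg1].
- have [v vP] := joins_ex p true ij; have [w wP] := joins_ex p false ij.
  by eexists; [apply: leading6 vP wP | rewrite !mdegD !mdeg1].
- have {}ij : i1 != j by rewrite -val_eqE /=; lia.
  have [v vP] := joins_ex p true ij; have [w wP] := joins_ex p false ij.
  by eexists; [apply: leading7 vP wP | rewrite !mdegD !mdeg1].
- have i1i : i1 != i by rewrite -val_eqE /=; lia.
  have [u uP] := joins_ex true p i1i; have [v vP] := joins_ex false p i1i.
  have [w wP] := joins_ex q r jk.
  by eexists; [apply: leading8 uP vP wP | rewrite !mdegD !mdeg1].
Qed.

Lemma leading_initial g a : leading g a -> g != 0 /\ is_initial (prec lt) g a.
Proof.
case=> b [-> ba _].
have ab : (b == a) = false by apply: contraTF ba => /eqP->; rewrite prec_irr.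
have ga : a \in msupp ('X_[a] - 'X_[b] : {mpoly K[nvars n]}).
  by rewrite mcoeff_msupp mcoeffB !mcoeffX eqxx ab subr0 oner_eq0.
split; first by apply: contraTneq ga => ->; rewrite msupp0.
split=> // m'; rewrite mcoeff_msupp mcoeffB !mcoeffX.
have [<- _ /eqP//|_] := eqVneq a m'.
by have [<-|_ /eqP] := eqVneq b m'; rewrite ?subrr.
Qed.

End Leading.

(** * Signed multigraphs *)

Section Edges.
Variable n : nat.
Implicit Types (m : 'X_{1..nvars n}) (v w : xvar n) (x y c i j k l : 'I_n).
Implicit Types p q r s : bool.

Definition edge m i j p q : Prop :=
  exists2 v, joins v i j p q & (0 < m (xindex v))%N.

Lemma edgeC m i j p q : edge m i j p q -> edge m j i q p.
Proof. by case=> v vij mv; exists v; rewrite // joins_sym. Qed.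

Lemma edge_neq m i j p q : edge m i j p q -> i != j.
Proof. by case=> v /joins_neq. Qed.

Lemma edge_self m v : (0 < m (xindex v))%N ->
  edge m (xvar_i v) (xvar_j v) (xvar_p v) (xvar_q v).
Proof. by exists v; rewrite ?joins_self. Qed.

Lemma joins_at v c i j p q r s :
  joins v c i p q -> joins v c j r s -> [/\ i = j, p = r & q = s].
Proof.
case/joinsP => lt1 <- <- <- <-; case/joinsP => lt2 e1 e2 e3 e4; split=> //;
by move: (xvar_lt v); rewrite ?e1 ?e2 -?e1 ?ltnn.
Qed.

(** The exponents of t_x above and below the fraction bar count the edges that
    carry the sign + or the sign - at [x]. *)
Definition sign_count m x p : nat :=
  if p then numer m (tindex x) else denom m (tindex x).

Definition degree m x : nat := (sign_count m x true + sign_count m x false)%N.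

(** The absolute value of the signed degree at [x], so that it depends only on
    the image of [m]. *)
Definition imbalance m x : nat :=
  ((sign_count m x true - sign_count m x false)
   + (sign_count m x false - sign_count m x true))%N.

Lemma sign_countE m x p : sign_count m x p =
  (\sum_v (((xvar_i v == x) && (xvar_p v == p))
         + ((xvar_j v == x) && (xvar_q v == p))) * m (xindex v))%N.
Proof.
rewrite /sign_count; case: p; rewrite ?numerE ?denomE ?mnmDE mnm_sumE.
  rewrite mulmnE mnm1E max_tindex addn0; apply: eq_bigr => v _.
  rewrite mulmnE !mnmDE !mulmnE !mnm1E max_tindex addn0 !tindex_eq !eqb_id.
  by rewrite !mulnb.
apply: eq_bigr => v _.
by rewrite mulmnE !mnmDE !mulmnE !mnm1E !tindex_eq !mulnb !eqbF_neg.
Qed.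

Lemma sign_count_gt0P m x p :
  (0 < sign_count m x p)%N <-> exists k q, edge m x k p q.
Proof.
rewrite sign_countE lt0n sum_nat_eq0 negb_forall; split.
  case/existsP => v; rewrite /= muln_eq0 negb_or -!lt0n addn_gt0 !lt0b.
  case/andP => /orP[] /andP[/eqP<- /eqP<-] mv.
    by exists (xvar_j v), (xvar_q v); apply: edge_self.
  by exists (xvar_i v), (xvar_p v); apply/edgeC/edge_self.
case=> k [q [v /joinsP vxk mv]]; apply/existsP; exists v.
rewrite /= muln_eq0 negb_or -!lt0n mv andbT addn_gt0.
by case: vxk => _ -> -> -> ->; rewrite !eqxx ?orbT.
Qed.

(** Double counting of the pairs of an edge and an endpoint of it in [Q]. *)
Lemma sum_degree m (Q : pred 'I_n) :
  (\sum_(x | Q x) degree m x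
   = \sum_v (Q (xvar_i v) + Q (xvar_j v)) * m (xindex v))%N.
Proof.
under eq_bigr => x _ do rewrite /degree !sign_countE -big_split /=.
rewrite exchange_big /=; apply: eq_bigr => v _.
under eq_bigr => x _ do rewrite -mulnDl.
rewrite -big_distrl /=; congr (_ * _)%N.
have sum_at y : (\sum_(x | Q x) (y == x) = Q y)%N.
  rewrite big_mkcond (bigD1 y) //= eqxx big1 ?addn0 => [|x /negPf].
    by case: (Q y).
  by rewrite eq_sym => ->; case: (Q x).
rewrite -!sum_at -big_split; apply: eq_bigr => x _ /=.
by do 2!case: (_ == x); case: (xvar_p v); case: (xvar_q v).
Qed.

Lemma sum_degree_all m : (\sum_x degree m x = 2 * xdeg m)%N.
Proof. by rewrite sum_degree /xdeg big_distrr. Qed.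

Lemma degree_le m x : (degree m x <= xdeg m)%N.
Proof.
rewrite -[degree m x](big_pred1_eq addn x (degree m)) sum_degree.
apply: leq_sum => v _; rewrite -{2}[m _]mul1n leq_mul2r; apply/orP; right.
by move: (xvar_lt v); case: eqP => [->|_]; case: eqP => [->|_] //; rewrite ltnn.
Qed.

Lemma imbalance_le m x : (imbalance m x <= degree m x)%N.
Proof. by rewrite /imbalance /degree; lia. Qed.

Lemma same_fibre_count m1 m2 x : same_fibre m1 m2 ->
  (sign_count m1 x true + sign_count m2 x false
   = sign_count m2 x true + sign_count m1 x false)%N.
Proof. by rewrite /same_fibre => /mnmP/(_ (tindex x)); rewrite !mnmDE. Qed.

Lemma same_fibre_imbalance m1 m2 x :
  same_fibre m1 m2 -> imbalance m1 x = imbalance m2 x.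
Proof. by move/(same_fibre_count x); rewrite /imbalance; lia. Qed.

Definition unmixed m : Prop := forall x j k p q r s,
  edge m x j p q -> edge m x k r s -> p = r.

(** A star with centre [c] and sign [p] at [c], in which both signs occur at
    the vertex [y]. *)
Definition mixed_star m c y p : Prop :=
  [/\ edge m c y p true, edge m c y p false
    & forall v, (0 < m (xindex v))%N -> exists k q, joins v c k p q].

Lemma unmixed_count m x : unmixed m ->
  sign_count m x true = 0%N \/ sign_count m x false = 0%N.
Proof.
move=> unm; have [->|] := posnP (sign_count m x true); first by left.
move/sign_count_gt0P => [j [q xj]]; right; apply/eqP; rewrite -leqn0 leqNgt.
by apply/negP => /sign_count_gt0P[k [r /(unm _ _ _ _ _ _ _ xj)]].
Qed.

Lemma unmixed_imbalance m x : unmixed m -> imbalance m x = degree m x.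
Proof. by move/(unmixed_count x); rewrite /imbalance /degree; lia. Qed.

(** Without cancellation of signs the imbalances are the degrees of a loopless
    multigraph, and every edge at [c] has another endpoint. *)
Lemma unmixed_balanced m c :
  unmixed m -> (2 * imbalance m c <= \sum_x imbalance m x)%N.
Proof.
move=> unm; under eq_bigr => x _ do rewrite unmixed_imbalance //.
by rewrite sum_degree_all unmixed_imbalance // leq_mul2l degree_le.
Qed.

Lemma mixed_star_count m c y p : mixed_star m c y p ->
  (0 < sign_count m c p)%N /\ sign_count m c (~~ p) = 0%N.
Proof.
case=> cy _ star; split; first by apply/sign_count_gt0P; eauto.
apply/eqP; rewrite -leqn0 leqNgt.
apply/negP => /sign_count_gt0P[k [q [v vck mv]]].
have [k' [q' vck']] := star v mv.
by have [_ e _] := joins_at vck vck'; case: (p) e.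
Qed.

(** The degree at [c] is the sum of the other degrees, and at [y] the two signs
    make the imbalance strictly smaller than the degree. *)
Lemma mixed_star_dominant m c y p :
  mixed_star m c y p -> (\sum_x imbalance m x < 2 * imbalance m c)%N.
Proof.
move=> mix; have [_ nocount] := mixed_star_count mix.
have -> : imbalance m c = degree m c.
  by move: nocount; rewrite /imbalance /degree; case: p {mix} => /=; lia.
case: mix => cy1 cy0 star.
have -> : degree m c = xdeg m.
  rewrite -[degree m c](big_pred1_eq addn c (degree m)) sum_degree.
  apply: eq_bigr => v _; have [->|] := posnP (m (xindex v)).
    by rewrite muln0.
  case/star => k [q /joinsP[] lt_ck -> -> _ _]; rewrite eqxx -val_eqE /=.
    by rewrite gtn_eqF // mul1n.
  by rewrite ltn_eqF // mul1n.
rewrite -sum_degree_all (bigD1 y) //= [X in (_ < X)%N](bigD1 y) //=.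
rewrite -addSn leq_add ?leq_sum // => [|x _]; last exact: imbalance_le.
have : (0 < sign_count m y true)%N.
  by apply/sign_count_gt0P; exists c, p; apply: edgeC.
have : (0 < sign_count m y false)%N.
  by apply/sign_count_gt0P; exists c, p; apply: edgeC.
by rewrite /imbalance /degree; lia.
Qed.

(** Edges with a common vertex always satisfy this; disjoint ones do if and only
    if they cross. *)
Definition sorted_edges m : Prop := forall v w,
  (0 < m (xindex v))%N -> (0 < m (xindex w))%N ->
  (xvar_i v <= xvar_j w)%N /\
  ((xvar_i v <= xvar_i w)%N /\ (xvar_j v <= xvar_j w)%N \/
   (xvar_i w <= xvar_i v)%N /\ (xvar_j w <= xvar_j v)%N).

Definition least_edge m e : Prop :=
  (0 < m (xindex e))%N /\ forall v, (0 < m (xindex v))%N ->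
  [/\ (xvar_i e <= xvar_i v)%N, (xvar_j e <= xvar_j v)%N
    & (xvar_i v <= xvar_j e)%N].

Lemma least_edge_ex m :
  sorted_edges m -> (0 < xdeg m)%N -> exists e, least_edge m e.
Proof.
move=> srt /xdeg_gt0P[v0 mv0].
(* Minimality for the lexicographic order on the pairs (i, j). *)
pose key v := (xvar_i v * n + xvar_j v)%N.
case: (arg_minnP (P := fun v => 0 < m (xindex v))%N key mv0) => e me min_e.
exists e; split=> // v mv; have := min_e v mv; rewrite /key => le_ev.
have [le_ve _] := srt v e mv me; have [_ srt_ev] := srt e v me mv.
have le_i : (xvar_i e <= xvar_i v)%N.
  rewrite leqNgt; apply/negP => lt_i.
  have := leq_mul2r n (xvar_i v).+1 (xvar_i e); rewrite lt_i orbT mulSn.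
  by move: (ltn_ord (xvar_j v)) le_ev; lia.
split=> //; case: srt_ev => [[]//|[le_i' le_j']].
have e_i : xvar_i e = xvar_i v :> nat by lia.
by move: le_ev; rewrite e_i; lia.
Qed.

(** The smaller endpoint of the least edge is the first vertex of positive
    degree. *)
Lemma least_edge_i m1 m2 e1 e2 :
  (forall x, degree m1 x = degree m2 x) ->
  least_edge m1 e1 -> least_edge m2 e2 -> (xvar_i e2 <= xvar_i e1)%N.
Proof.
move=> eq_deg [m1e1 _] [_ min2].
have : (0 < degree m2 (xvar_i e1))%N.
  rewrite -eq_deg addn_gt0; have := edge_self m1e1.
  by case: (xvar_p e1) => h; apply/orP; [left|right];
    apply/sign_count_gt0P; eauto.
rewrite addn_gt0 => /orP[] /sign_count_gt0P[k [q [v vk mv]]];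
by have [le_i _ _] := min2 v mv; move: le_i (xvar_lt v);
  case/joinsP: vk => _ -> -> _ _; lia.
Qed.

(** Let j1 be the larger endpoint of [e1].  All edges of [m1] have an endpoint
    at most j1, and [e1] has two, so the degrees up to j1 sum to more than the
    number of edges.  If all edges of [m2] ended after j1, the same sum would
    be at most the number of edges. *)
Lemma least_edge_j m1 m2 e1 e2 :
  (forall x, degree m1 x = degree m2 x) ->
  least_edge m1 e1 -> least_edge m2 e2 -> (xvar_j e2 <= xvar_j e1)%N.
Proof.
move=> eq_deg [m1e1 min1] [_ min2]; rewrite leqNgt; apply/negP => lt_j.
have eq_xdeg : xdeg m1 = xdeg m2.
  have := sum_degree_all m2; rewrite -(eq_bigr _ (fun x _ => eq_deg x)).
  by rewrite sum_degree_all; lia.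
pose Q x := (x <= xvar_j e1)%N.
have := sum_degree m1 Q; rewrite (eq_bigr _ (fun x _ => eq_deg x)) sum_degree.
have : (\sum_v (Q (xvar_i v) + Q (xvar_j v)) * m2 (xindex v) <= xdeg m2)%N.
  apply: leq_sum => v _; have [->|mv] := posnP (m2 (xindex v)).
    by rewrite muln0.
  have [_ le_j _] := min2 v mv.
  have -> : Q (xvar_j v) = false by rewrite /Q; lia.
  by case: (Q _); rewrite ?mul1n.
have : (xdeg m1 < \sum_v (Q (xvar_i v) + Q (xvar_j v)) * m1 (xindex v))%N.
  rewrite /xdeg (bigD1 e1) //= [X in (_ < X)%N](bigD1 e1) //= -addSn leq_add //.
    have [_ _ le_i] := min1 e1 m1e1.
    by rewrite /Q leqnn le_i mulnDl mul1n -addn1 leq_add2l.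
  apply: leq_sum => v _; have [->|mv] := posnP (m1 (xindex v)); first by [].
  by have [_ _ le_i] := min1 v mv; rewrite {1}/Q le_i mulnDl mul1n leq_addr.
by rewrite eq_xdeg; lia.
Qed.

(** The image determines the degrees, which determine the endpoints of the least
    edge, and also which sign occurs at each vertex. *)
Lemma sorted_common m1 m2 :
  unmixed m1 -> unmixed m2 -> sorted_edges m1 -> sorted_edges m2 ->
  same_fibre m1 m2 -> (0 < xdeg m1)%N ->
  exists v, (0 < m1 (xindex v))%N /\ (0 < m2 (xindex v))%N.
Proof.
move=> unm1 unm2 srt1 srt2 fib m1_gt0.
have eq_count x p : sign_count m1 x p = sign_count m2 x p.
  move: (same_fibre_count x fib) (unmixed_count x unm1) (unmixed_count x unm2).
  by case: p; lia.
have eq_deg x : degree m1 x = degree m2 x by rewrite /degree !eq_count.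
have eq_deg' x : degree m2 x = degree m1 x by [].
have m2_gt0 : (0 < xdeg m2)%N.
  have := sum_degree_all m2; rewrite -(eq_bigr _ (fun x _ => eq_deg x)).
  by rewrite sum_degree_all; lia.
have [e1 least1] := least_edge_ex srt1 m1_gt0.
have [e2 least2] := least_edge_ex srt2 m2_gt0.
have ei : xvar_i e1 = xvar_i e2.
  by apply/val_inj/eqP; rewrite eqn_leq (least_edge_i eq_deg' least2 least1)
    (least_edge_i eq_deg least1 least2).
have ej : xvar_j e1 = xvar_j e2.
  by apply/val_inj/eqP; rewrite eqn_leq (least_edge_j eq_deg' least2 least1)
    (least_edge_j eq_deg least1 least2).
have [m1e1 _] := least1; have [m2e2 _] := least2.
have edge1 := edge_self m1e1; have edge2 := edge_self m2e2.
have sign_eq x k l p q r s : edge m1 x k p q -> edge m2 x l r s -> p = r.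
  move=> xk xl; have /sign_count_gt0P[k' [q' xk']] : (0 < sign_count m2 x p)%N.
    by rewrite -eq_count; apply/sign_count_gt0P; eauto.
  exact: unm2 xk' xl.
rewrite -ei -ej in edge2.
have ep := sign_eq _ _ _ _ _ _ _ edge1 edge2.
have eq := sign_eq _ _ _ _ _ _ _ (edgeC edge1) (edgeC edge2).
have e12 : e2 = e1.
  by apply: (joins_inj (joins_self e2)); rewrite -ei -ej -ep -eq joins_self.
by exists e1; split=> //; rewrite -e12.
Qed.

End Edges.

(** * Standard monomials *)

Section Standard.
Variables (n : nat) (K : fieldType) (lt : rel (xvar n)).
Hypothesis lt_order : is_var_order lt.
Implicit Types (m : 'X_{1..nvars n}) (u v w : xvar n) (x c i j k l : 'I_n).
Implicit Types p q r s : bool.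

Definition standard m : Prop := forall (g : {mpoly K[nvars n]}) a,
  toric_binomial g -> leading lt g a -> ~~ (a <= m)%MM.

Lemma standard_divisor m m' : (m' <= m)%MM -> standard m -> standard m'.
Proof.
move=> m'm std g a Gg ga; apply/negP => am'; move/negP: (std g a Gg ga); apply.
exact: lepm_trans m'm.
Qed.

Lemma standard_pair m v w g : standard m -> v != w ->
  (0 < m (xindex v))%N -> (0 < m (xindex w))%N ->
  toric_binomial g -> ~ @leading n K lt g (U_(xindex v) + U_(xindex w)).
Proof.
move=> std vw mv mw Gg lead; move/negP: (std g _ Gg lead); apply.
apply/mnm_lepP => k; rewrite mnmDE !mnm1E.
have [<-|_] := eqVneq (xindex v) k.
  by rewrite eq_sym xindex_eq (negPf vw).
by have [<-|] := eqVneq (xindex w) k.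
Qed.

Lemma standard_cross m i j k l p q r s : standard m ->
  (i < j)%N -> (j < k)%N -> (k < l)%N ->
  edge m i j p q -> edge m k l r s -> False.
Proof.
move=> std ij jk kl [v vij mv] [w wkl mw].
apply: standard_pair std _ mv mw (ToricBinomial1 K p q r s ij jk kl) _.
  by apply/eqP => e; move: (joins_min wkl); rewrite -e (joins_min vij); lia.
exact: leading1.
Qed.

Lemma standard_nest m i j k l p q r s : standard m ->
  (i < j)%N -> (j < k)%N -> (k < l)%N ->
  edge m i l p s -> edge m j k q r -> False.
Proof.
move=> std ij jk kl [v vil mv] [w wjk mw].
apply: standard_pair std _ mv mw (ToricBinomial2 K p q r s ij jk kl) _.
  by apply/eqP => e; move: (joins_min wjk); rewrite -e (joins_min vil); lia.
exact: leading2.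
Qed.

Lemma standard_sorted m : standard m -> sorted_edges m.
Proof.
move=> std v w mv mw; have ev := edge_self mv; have ew := edge_self mw.
have := xvar_lt v; have := xvar_lt w.
have [lt1|] := ltnP (xvar_j v) (xvar_i w).
  by move=> hw hv; case: (standard_cross std hv lt1 hw ev ew).
have [lt1|] := ltnP (xvar_j w) (xvar_i v).
  by move=> _ hw hv; case: (standard_cross std hw lt1 hv ew ev).
have [lt1|] := ltnP (xvar_i v) (xvar_i w).
  have [lt2|] := ltnP (xvar_j w) (xvar_j v).
    by move=> _ _ hw hv; case: (standard_nest std lt1 hw lt2 ev ew).
  by move=> *; split; [|left]; lia.
have [lt1|] := ltnP (xvar_i w) (xvar_i v).
  have [lt2|] := ltnP (xvar_j v) (xvar_j w).
    by move=> _ _ _ hw hv; case: (standard_nest std lt1 hv lt2 ew ev).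
  by move=> *; split; [|right]; lia.
by move=> *; split; lia.
Qed.

Lemma standard_partner m i j k p q :
  standard m -> edge m i j true p -> edge m i k false q -> j = k.
Proof.
move=> std [v vij mv] [w wik mw]; apply/eqP/negPn/negP => jk.
apply: standard_pair std _ mv mw (ToricBinomial3 K p q _ _ jk) _.
- by apply/eqP => e; rewrite -e in wik; case: (joins_at vij wik).
- exact: joins_neq vij.
- exact: joins_neq wik.
- exact: leading3.
Qed.

Lemma standard_partnerN m i j k p q r :
  standard m -> edge m i j p q -> edge m i k (~~ p) r -> j = k.
Proof.
move=> std; case: p => ij ik; first exact: standard_partner ij ik.
by apply/esym; apply: standard_partner ik ij.
Qed.

(** Up to exchanging the endpoints and the two edges, this is
    [ToricBinomial4] or [ToricBinomial5]. *)
Lemma standard_opposite m i j p q :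
  standard m -> edge m i j p q -> edge m i j (~~ p) (~~ q) -> False.
Proof.
move=> std; wlog: i j p q / p && (i < j)%N => [wl eij eij'|].
  case: p eij eij' => eij eij'.
    have := edge_neq eij; rewrite neq_ltn => /orP[] lt_ij.
      by apply: wl eij eij'; rewrite lt_ij.
    case: q eij eij' => eij eij'; last first.
      by apply: (wl j i true false) (edgeC eij') (edgeC eij).
    by apply: (wl j i true true) (edgeC eij) (edgeC eij').
  have := edge_neq eij; rewrite neq_ltn => /orP[] lt_ij.
    by apply: (wl i j true (~~ q)) eij' _; rewrite ?negbK.
  case: q eij eij' => eij eij'.
    by apply: (wl j i true false) (edgeC eij) (edgeC eij').
  by apply: (wl j i true true) (edgeC eij') (edgeC eij).
case/andP => -> {p} ij [v vij mv] [w wij mw].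
have vw : v != w by apply/eqP => e; rewrite -e in wij; case: (joins_at vij wij).
case: q vij wij => vij wij.
  exact: standard_pair std vw mv mw (ToricBinomial4 K ij)
    (leading45 _ _ vij wij).
exact: standard_pair std vw mv mw (ToricBinomial5 K ij)
  (leading45 _ _ vij wij).
Qed.

Variables i1 il : 'I_n.
Hypotheses (i1_first : i1 = 0%N :> nat) (il_last : il = n.-1 :> nat).

(** Both signs at [j] on edges with a constant sign at [i]: [ToricBinomial6]
    makes one of the two indices equal to 1, and if it is not [j], then
    [ToricBinomial7] leaves only the last index for [j]. *)
Lemma standard_parallel m i j p : standard m ->
  edge m i j p true -> edge m i j p false ->
  j = i1 \/ i = i1 /\ j = il.
Proof.
move=> std [v vij mv] [w wij mw].
have vw : v != w by apply/eqP => e; rewrite -e in wij; case: (joins_at vij wij).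
have ij := joins_neq vij.
have [j0|j_gt0] := posnP j; first by left; apply: val_inj; rewrite /= i1_first.
have [i0|i_gt0] := posnP i; last first.
  case: (standard_pair std vw mv mw
    (ToricBinomial6 K p i1_first i_gt0 j_gt0 ij)).
  exact: leading6.
right; have e : i = i1 by apply: val_inj; rewrite /= i1_first.
subst i; split=> //; apply: val_inj; apply/eqP; rewrite eqn_leq /=.
apply/andP; split; first by rewrite il_last; move: (ltn_ord j); lia.
rewrite leqNgt; apply/negP => j_lt.
case: (standard_pair std vw mv mw
  (ToricBinomial7 K p i1_first il_last j_gt0 j_lt)).
exact: leading7.
Qed.

Lemma standard_disjoint m i j k p q r : standard m ->
  edge m i1 i true p -> edge m i1 i false p -> edge m j k q r ->
  [\/ j = i1, j = i, k = i1 | k = i].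
Proof.
move=> std [u uP mu] [v vP mv] [w wP mw]; apply: NNPP => none.
have [ji ki] : i != j /\ i != k.
  by split; apply/eqP => e; apply: none; [constructor 2|constructor 4].
have gt0 x : x <> i1 -> (0 < x)%N.
  move=> xi1; rewrite lt0n; apply/eqP => x0; apply/xi1/val_inj.
  by rewrite /= i1_first.
have j_gt0 : (0 < j)%N by apply: gt0 => e; apply: none; constructor 1.
have k_gt0 : (0 < k)%N by apply: gt0 => e; apply: none; constructor 3.
have i_gt0 : (0 < i)%N by apply: gt0 => e; have := joins_neq uP; rewrite e eqxx.
move/negP: (std _ _ (ToricBinomial8 K p q r i1_first i_gt0 j_gt0 k_gt0 ji ki
  (joins_neq wP)) (leading8 K lt ji ki uP vP wP)); apply.
have uv : u != v by apply/eqP => e; rewrite e in uP; case: (joins_at uP vP).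
have at1 t : t = u \/ t = v -> t != w.
  move=> tuv; apply/eqP => e; have : xvar_i w = 0%N :> nat.
    by rewrite -e; case: tuv => ->;
      rewrite ?(joins_min uP) ?(joins_min vP) i1_first min0n.
  by rewrite (joins_min wP); lia.
have uw := at1 u (or_introl erefl); have vw := at1 v (or_intror erefl).
apply/mnm_lepP => h; rewrite !mnmDE !mnm1E.
have [<-|_] := eqVneq (xindex u) h.
  by rewrite ![_ == xindex u]eq_sym !xindex_eq (negPf uv) (negPf uw).
have [<-|_] := eqVneq (xindex v) h; last by have [<-|] := eqVneq (xindex w) h.
by rewrite eq_sym xindex_eq (negPf vw).
Qed.

(** The vertex with both signs in a mixed star with centre [c]. *)
Definition star_partner c : 'I_n := if c == i1 then il else i1.

(** Let both signs occur at [x].  All edges at [x] go to one neighbour [c], with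
    a constant sign [p] at [c].  An edge with the other sign at [c] would have
    to go to [x], where it would be opposite to one of the edges from [c] with
    sign [p].  An edge that avoids both [x] and [c] is excluded by
    [ToricBinomial8] if [x] is 1, and by [ToricBinomial2] if [c] is 1 and [x] is
    n, since it is then nested inside the edge 1n. *)
Lemma standard_dichotomy m : standard m ->
  unmixed m \/ exists c p, mixed_star m c (star_partner c) p.
Proof.
move=> std; have [unm|/not_all_ex_not[x mixed]] := classic (unmixed m).
  by left.
right.
have [c [p [xE cp1 cp0]]] : exists c p,
  [/\ x = star_partner c, edge m x c true p & edge m x c false p].
  have [j [k [q [s [xj xk]]]]] : exists j k q s,
      edge m x j true q /\ edge m x k false s.
    apply: NNPP => none; apply: mixed => j k [] q [] s xj xk //; case: none.
      by exists j, k, q, s.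
    by exists k, j, s, q.
  have ejk := standard_partner std xj xk; subst k.
  have eqs : q = s.
    case: (q =P s) => // ne; case: (standard_opposite std xj).
    by have -> : ~~ q = s by case: q s ne {xj xk} => [] [].
  subst s; exists j, q; split=> //; rewrite /star_partner.
  have [e|[-> ->]] := standard_parallel std (edgeC xj) (edgeC xk);
    last by rewrite eqxx.
  by rewrite -e eq_sym (negPf (edge_neq xj)).
exists c, p; rewrite -xE.
split; [exact: edgeC cp1 | exact: edgeC cp0 | move=> v mv].
have at_c k r s : edge m c k r s -> r = p.
  move=> ck; apply/eqP/negPn/negP => rp.
  have {}rp : r = ~~ p by case: r p rp {ck cp1 cp0} => [] [].
  subst r; have xk : x = k by apply: standard_partnerN std (edgeC cp1) ck.
  subst k; case: s ck => ck.
    by apply: standard_opposite std (edgeC cp0) ck.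
  by apply: standard_opposite std (edgeC cp1) ck.
have at_x k r s : edge m x k r s -> k = c.
  case: r => xk; first by apply: standard_partner xk cp0.
  by apply/esym; apply: standard_partner cp1 xk.
have ev := edge_self mv.
have [ci|ci] := eqVneq (xvar_i v) c.
  rewrite ci in ev; exists (xvar_j v), (xvar_q v).
  by rewrite -(at_c _ _ _ ev) -ci joins_self.
have [cj|cj] := eqVneq (xvar_j v) c.
  rewrite cj in ev; exists (xvar_i v), (xvar_p v).
  by rewrite -(at_c _ _ _ (edgeC ev)) -cj joins_sym joins_self.
have xi : xvar_i v != x.
  by apply: contraNneq cj => xi; rewrite xi in ev; rewrite (at_x _ _ _ ev).
have xj : xvar_j v != x.
  apply: contraNneq ci => xj; rewrite xj in ev.
  by rewrite (at_x _ _ _ (edgeC ev)).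
case: (eqVneq c i1) xE => [ec|nc]; rewrite /star_partner.
  rewrite ec eqxx => ex; rewrite ex in cp1 xi xj.
  move: ci xj (xvar_lt v) (ltn_ord (xvar_j v)); rewrite ec -!val_eqE /=.
  rewrite i1_first il_last => ci xj lt_v lt_n.
  case: (@standard_nest m i1 (xvar_i v) (xvar_j v) il p (xvar_p v)
    (xvar_q v) true) => //.
  - by rewrite i1_first; lia.
  - by rewrite il_last; lia.
  - by apply: edgeC; rewrite -ec.
rewrite (negPf nc) => ex; subst x.
by case: (standard_disjoint std cp1 cp0 ev) => e; move: ci cj xi xj;
  rewrite e eqxx.
Qed.

(** The inequality of [unmixed_balanced] and the opposite one of
    [mixed_star_dominant] concern the imbalances alone, so the two cases cannot
    share an image.  Two dominant vertices coincide, and the sign at the centre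
    of a star is the sign of its exponent, so two stars with the same image
    share an edge from the centre to its partner. *)
Lemma standard_common m1 m2 :
  standard m1 -> standard m2 -> same_fibre m1 m2 -> (0 < xdeg m1)%N ->
  exists v, (0 < m1 (xindex v))%N /\ (0 < m2 (xindex v))%N.
Proof.
move=> std1 std2 fib m1_gt0.
have imbE : (\sum_x imbalance m1 x = \sum_x imbalance m2 x)%N.
  by apply: eq_bigr => x _; apply: same_fibre_imbalance.
have [unm1|[c1 [p1 star1]]] := standard_dichotomy std1;
have [unm2|[c2 [p2 star2]]] := standard_dichotomy std2.
- by apply: sorted_common => //; apply: standard_sorted.
- have := mixed_star_dominant star2; have := unmixed_balanced c2 unm1.
  by rewrite imbE (same_fibre_imbalance c2 fib); lia.
- have := mixed_star_dominant star1; have := unmixed_balanced c1 unm2.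
  by rewrite imbE (same_fibre_imbalance c1 fib); lia.
have dom1 := mixed_star_dominant star1; have dom2 := mixed_star_dominant star2.
have c12 : c1 = c2.
  apply/eqP/negPn/negP => c12; move: dom1 dom2; rewrite imbE.
  rewrite (same_fibre_imbalance c1 fib) (bigD1 c1) //= (bigD1 c2) 1?eq_sym //=.
  by lia.
subst c2; have [cw1 _ _] := star1; have [cw1' _ _] := star2.
have p12 : p1 = p2.
  move: (mixed_star_count star1) (mixed_star_count star2).
  move: (same_fibre_count c1 fib).
  by case: (p1); case: (p2) => //=; lia.
subst p2; case: cw1 cw1' => v vP mv [v' v'P mv'].
by exists v; split=> //; rewrite (joins_inj vP v'P).
Qed.

Lemma standard_uniq m1 m2 :
  standard m1 -> standard m2 -> same_fibre m1 m2 -> m1 = m2.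
Proof.
have [d] := ubnP (xdeg m1); elim: d m1 m2 => // d IHd m1 m2.
rewrite ltnS => le_d std1 std2 fib; have [m1_0|m1_gt0] := posnP (xdeg m1).
  (* A standard monomial with the image of a power of z has no edges either. *)
  have m2_0 : xdeg m2 = 0%N.
    apply/eqP; rewrite -leqn0 leqNgt; apply/negP => m2_gt0.
    have [v [_ mv]] := standard_common std2 std1 (same_fibre_sym fib) m2_gt0.
    by have : (0 < xdeg m1)%N; [apply/xdeg_gt0P; exists v | rewrite m1_0].
  apply: monomial_ext => [|v].
    by have := same_fibre_deg fib; rewrite m1_0 m2_0.
  move/eqP: m1_0; rewrite /xdeg sum_nat_eq0 => /forallP/(_ v)/eqP->.
  by move/eqP: m2_0; rewrite /xdeg sum_nat_eq0 => /forallP/(_ v)/eqP->.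
have [v [m1v m2v]] := standard_common std1 std2 fib m1_gt0.
have vm1 : (U_(xindex v) <= m1)%MM by rewrite lep1mP -lt0n.
have vm2 : (U_(xindex v) <= m2)%MM by rewrite lep1mP -lt0n.
have m1E := submK vm1; have m2E := submK vm2.
rewrite addmC in m1E; rewrite addmC in m2E; rewrite -m1E -m2E; congr (_ + _)%MM.
apply: IHd.
- by move: le_d; rewrite -{1}m1E xdegD xdeg_x add1n.
- exact: standard_divisor (lem_subr _ _) std1.
- exact: standard_divisor (lem_subr _ _) std2.
- by apply: (proj1 (same_fibre_add U_(xindex v) _ _)); rewrite m1E m2E.
Qed.

End Standard.

(** * The Groebner basis property *)

Lemma seq_of_subset (T : eqType) (P : T -> Prop) (s0 : seq T) :
  (forall x, P x -> x \in s0) -> exists s : seq T, forall x, P x <-> x \in s.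
Proof.
elim: s0 P => [|y s0 IH] P sub.
  by exists [::] => x; split=> // /sub.
have [|s sP] := IH (fun x => P x /\ x <> y).
  by move=> x [Px xy]; move: (sub x Px); rewrite inE => /orP[/eqP|].
have [Py|nPy] := classic (P y); [exists (y :: s) | exists s] => x.
  rewrite inE; split=> [Px|/orP[/eqP->|/sP[]]] //.
  by have [//|/eqP xy] := eqVneq x y; apply/sP.
by split=> [Px|/sP[]//]; apply/sP; split=> // xy; apply: nPy; rewrite -xy.
Qed.

Section IdealSpan.
Variables (N : nat) (K : fieldType).
Implicit Types (S : {mpoly K[N]} -> Prop) (f g h : {mpoly K[N]}).

Lemma ideal_span_mul S g h : S g -> ideal_span S (h * g).
Proof.
move=> Sg; exists [:: (h, g)]; rewrite ?big_seq1 // => t.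
by rewrite inE => /eqP->.
Qed.

Lemma ideal_span_sub S S' : (forall g, S g -> ideal_span S' g) ->
  forall f, ideal_span S f -> ideal_span S' f.
Proof.
move=> sub f [c cS ->]; elim: c cS => [|t c IH] cS.
  by exists [::]; rewrite ?big_nil.
rewrite big_cons; have [|d dS' ->] := IH.
  by move=> u uc; apply: cS; rewrite inE uc orbT.
have [|e eS' ->] := sub t.2; first by apply: cS; rewrite mem_head.
exists ([seq (t.1 * u.1, u.2) | u <- e] ++ d) => [u|].
  rewrite mem_cat => /orP[/mapP[u' u'e ->]|ud]; [exact: eS' u'e | exact: dS'].
rewrite big_cat big_map mulr_sumr; congr (_ + _).
by apply: eq_bigr => u _; rewrite mulrA.
Qed.

End IdealSpan.

Section Groebner.
Variables (n : nat) (K : fieldType) (lt : rel (xvar n)).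
Hypotheses (n_gt0 : (0 < n)%N) (lt_order : is_var_order lt).
Implicit Types m : 'X_{1..nvars n}.

Lemma not_standard m : ~ standard K lt m ->
  exists g a, [/\ @toric_binomial n K g, leading lt g a & (a <= m)%MM].
Proof.
move=> nstd; apply: NNPP => none; apply: nstd => g a Gg lead.
by apply/negP => am; apply: none; exists g, a.
Qed.

(** Replacing X^a by X^b inside a monomial keeps the image and decreases the
    monomial, so this process ends. *)
Lemma standard_reduct m :
  exists m', [/\ standard K lt m', same_fibre m' m & m' = m \/ prec lt m' m].
Proof.
elim/(prec_ind lt_order): m => m IH.
have [std|/not_standard[g [a [Gg [b [_ ba fib]] am]]]] :=
  classic (standard K lt m).
  by exists m; split=> //; left.
have lt_m : prec lt (m - a + b) m by rewrite -{2}(submK am) prec_add.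
have fib_m : same_fibre (m - a + b) m.
  by rewrite -{2}(submK am); apply/same_fibre_add.
have [m' [std fib' le_m']] := IH _ lt_m; exists m'; split=> //.
  exact: (same_fibre_trans fib' fib_m).
right; case: le_m' => [->|] // lt_m'.
by apply: prec_trans lt_order _ _ _ lt_m' lt_m.
Qed.

(** A second monomial of [f] with the image of [m] would reduce to [m] by
    uniqueness, although it is smaller than [m]. *)
Lemma initial_not_standard (f : {mpoly K[nvars n]}) m :
  toric_ideal f -> is_initial (prec lt) f m -> ~ standard K lt m.
Proof.
move=> f0 [mf lt_m] std.
have [m' [m'f m'm fib]] := toric_ideal_fibre f0 mf.
have [m'' [std'' fib'' le_m'']] := standard_reduct m'.
have lastP : (n.-1 < n)%N by rewrite prednK.
have e : m'' = m.
  exact: (@standard_uniq n K lt lt_order (Ordinal n_gt0) (Ordinal lastP) erefl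
    erefl _ _ std'' std (same_fibre_trans fib'' fib)).
have lt_m' := lt_m _ m'f m'm; rewrite {}e in le_m''.
case: le_m'' => [e|lt_mm']; first by rewrite e eqxx in m'm.
by have := prec_trans lt_order lt_mm' lt_m'; rewrite prec_irr.
Qed.

Lemma toric_binomial_mem (g : {mpoly K[nvars n]}) :
  toric_binomial g -> g != 0 /\ toric_ideal g.
Proof.
move=> Gg; have [a lead _] := toric_binomial_leading lt_order Gg.
have [g0 _] := leading_initial lead; split=> //.
by have [b [-> _ fib]] := lead; apply/same_fibre_toric/same_fibre_sym.
Qed.

Lemma toric_binomial_finite :
  exists s : seq {mpoly K[nvars n]}, forall g, toric_binomial g <-> g \in s.
Proof.
pose M := 'X_{1..(nvars n) < 4}.
apply: (@seq_of_subset _ _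
  [seq 'X_[ab.1 : M] - 'X_[ab.2 : M] | ab <- enum {: M * M}]).
move=> g Gg; have [a [b [-> _ fib]] lt_a] := toric_binomial_leading lt_order Gg.
have lt_b : (mdeg b < 4)%N.
  by rewrite mdeg_xz (same_fibre_deg fib) -mdeg_xz.
by apply/mapP; exists (BMultinom lt_a, BMultinom lt_b); rewrite ?mem_enum.
Qed.

End Groebner.

Theorem theorem4p1 (n : nat) (K : fieldType) (lt : rel (xvar n)) :
  (0 < n)%N -> is_var_order lt ->
  is_groebner_basis (prec lt) (@toric_ideal n K) (@toric_binomial n K).
Proof.
move=> n_gt0 lt_order; split; first exact: toric_binomial_finite lt_order.
  by move=> g; exact: (toric_binomial_mem lt_order).
move=> F; split; apply: ideal_span_sub => g [f [m [Gf f0 fm ->]]].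
  rewrite -['X_[m]]mul1r; apply: ideal_span_mul.
  by exists f, m; split=> //; case: (toric_binomial_mem lt_order Gf).
have [h [a [Gh lead am]]] :=
  not_standard (initial_not_standard n_gt0 lt_order Gf fm).
rewrite -(submK am) mpolyXD; apply: ideal_span_mul.
by have [h0 ha] := leading_initial lead; exists h, a.
Qed.
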